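(* Let $X$ be the classical risk process, $L$ the random field and $C$ the crossing process described in the context. Let $t>0$ and $x\in\mathbb{R}$. Then: (a) With probability 1, $L_t(x)\ge 0$ and the map $s\mapsto L_s(x)$ is non-decreasing. (b) With probability 1, $$L_t(x)=\frac1c\left(\frac12 1_{\{X_t\}}(x)-\frac12 1_{\{X_0\}}(x)+C_t(x)\right).$$ (c) For every bounded and Borel measurable function $g:\mathbb{R}\to\mathbb{R}$, with probability 1, $$\int_0^t g(X_s)\,ds=\int_{\mathbb{R}} g(y)\,L_t(y)\,dy .$$
   Context: The classical risk process is $X=\{X_t,t\ge 0\}$, $X_t=x_0+ct-\sum_{k=1}^{N_t}R_k$, where $x_0\ge 0$ and $c>0$ are constants, $N=\{N_t,t\ge0\}$ is a homogeneous Poisson process with rate $\alpha>0$, and $\{R_k,k\in\mathbb{N}\}$ is a sequence of i.i.d. non-negative random variables independent of $N$. It is assumed that $R_1$ has finite mean and is an absolutely continuous random variable (its law has a density with respect to Lebesgue measure). $X$ has càdlàg paths, $X_0=x_0$, and $X_{s-}$ denotes the left limit at $s>0$. The random field $L$ is defined for $t\ge 0$ and $x\in\mathbb{R}$ by $$L_t(x)=\frac1c\Big(\tfrac12 1_{\{x\}}(X_t)+1_{(x,\infty)}(X_t)-\tfrac12 1_{\{x\}}(x_0)-1_{(x,\infty)}(x_0)-\sum_{0<s\le t}\{1_{(x,\infty)}(X_s)-1_{(x,\infty)}(X_{s-})\}\Big).$$ It is well defined with probability 1, since almost surely $N_t<\infty$ for all $t>0$, so only finitely many summands are non-zero. Crossing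 process: there is a crossing with the level $x\in\mathbb{R}$ at time $s\in(0,+\infty)$ if for every open interval $I$ with $s\in I$, $x$ is an interior point of $\{X_t:t\in I\}$. The number of crossings with the level $x$ in the (open) time interval $(0,t)$ is denoted by $C_t(x)$.
   Formalization: In (b) the term −½·1_{X_0}(x) is corrected to +½·1_{X_0}(x): at x = x_0 on {N_t = 0} one has L_t(x_0) = 1/(2c) and C_t(x_0) = 0, so the printed formula fails; for x ≠ x_0 the two formulas coincide. *)

(* Defs.v *)
(* MathComp-Analysis. *)
From HB Require Import structures.
From mathcomp Require Export all_boot all_order all_algebra.
From mathcomp Require Export all_classical all_reals all_analysis.
Export Order.TTheory GRing.Theory Num.Theory.
Export numFieldNormedType.Exports.

Set Implicit Arguments.
Unset Strict Implicit.
Unset Printing Implicit Defensive.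

Local Open Scope classical_set_scope.
Local Open Scope ring_scope.

(* The product rule is required for every finite subfamily, listed by s. *)
Definition mutually_independent {d d'} {Omega : measurableType d}
    {T : measurableType d'} {R : realType} (P : probability Omega R)
    {I : eqType} (Y : I -> Omega -> T) : Prop :=
  forall (s : seq I) (B : I -> set T),
    uniq s -> (forall i, measurable (B i)) ->
    P (\bigcap_(i in [set` s]) Y i @^-1` B i) =
    (\prod_(i <- s) P (Y i @^-1` B i))%E.

Definition generated_sigma_algebra {d'} {Omega I : Type}
    {T : measurableType d'} (D : set I) (Y : I -> Omega -> T) :
    set (set Omega) :=
  <<s \bigcup_(i in D) preimage_set_system setT (Y i) measurable >>.

Definition independent_systems {d} {Omega : measurableType d} {R : realType}
    (P : probability Omega R) (F G : set (set Omega)) : Prop :=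
  forall A B, F A -> G B -> P (A `&` B) = (P A * P B)%E.

Definition identically_distributed {d d'} {Omega : measurableType d}
    {T : measurableType d'} {R : realType} (P : probability Omega R)
    {I : Type} (Y : I -> {RV P >-> T}) : Prop :=
  forall (i j : I) (A : set T), measurable A ->
    distribution P (Y i) A = distribution P (Y j) A.

Definition has_density {d} {Omega : measurableType d} {R : realType}
    (P : probability Omega R) (Y : {RV P >-> R}) : Prop :=
  exists f : R -> R,
    [/\ measurable_fun setT f, (forall y, 0 <= f y) &
        forall A : set R, measurable A ->
          distribution P Y A = (\int[lebesgue_measure]_(y in A) (f y)%:E)%E].

(* Times are the nonnegative reals: N s is unconstrained for s < 0.  The path
   properties hold outside a null set; there, paths being nondecreasing, the
   truncated difference of naturals is the actual increment.  For nat-valued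
   nondecreasing paths, being eventually constant on the right of every time
   amounts to being cadlag. *)
Definition poisson_process {d} {Omega : measurableType d} {R : realType}
    (P : probability Omega R) (alpha : R) (N : R -> {RV P >-> nat}) : Prop :=
  [/\ {ae P, forall w, [/\ N 0 w = 0%N,
        (forall s u, 0 <= s -> s <= u -> (N s w <= N u w)%N) &
        (forall s, 0 <= s -> \forall u \near s^'+, N u w = N s w)]},
      (forall u : nat -> R, 0 <= u 0%N -> {homo u : i j / (i <= j)%N >-> i <= j} ->
        mutually_independent P
          (fun i : nat => fun w => (N (u i.+1) w - N (u i) w)%N)) &
      (forall s t, 0 <= s -> s < t -> forall k : nat,
        P [set w | (N t w - N s w)%N = k] =
        (poisson_pmf (alpha * (t - s)) k)%:E)].

(* Claims are numbered from 0: Z k is the (k+1)-st claim. *)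
Definition risk_process {Omega : Type} {R : realType} (x0 c : R)
    (N : R -> Omega -> nat) (Z : nat -> Omega -> R) (t : R) (w : Omega) : R :=
  x0 + c * t - \sum_(k < N t w) Z k w.

Definition left_limit {R : realType} (f : R -> R) (s : R) : R :=
  lim (f u @[u --> s^'-]).

(* The sum over the uncountable index set ]0, t] is the sum over the support of
   the summand, when this support is finite. *)
Definition local_time {R : realType} (x0 c : R) (f : R -> R) (t x : R) : R :=
  c^-1 * (2^-1 * \1_[set x] (f t) + \1_`]x, +oo[ (f t)
          - 2^-1 * \1_[set x] x0 - \1_`]x, +oo[ x0
          - \sum_(s \in `]0, t])
              (\1_`]x, +oo[ (f s) - \1_`]x, +oo[ (left_limit f s) : R)).

(* The path f is indexed by nonnegative times, hence so is its range over I. *)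
Definition crossing {R : realType} (f : R -> R) (x s : R) : Prop :=
  0 < s /\
  forall I : interval R, open [set` I] -> s \in I ->
    interior (f @` [set u | u \in I /\ 0 <= u]) x.

(* Extended-real valued: +oo when there are infinitely many crossings.  The
   departure of a path from its starting level at time 0 is not a crossing; this
   is why, in terms of crossings, the local time carries the half unit
   + 2^-1 * \1_[set f 0] x. *)
Definition crossings {R : realType} (f : R -> R) (t x : R) : \bar R :=
  counting [set s | 0 < s < t /\ crossing f x s].

(* Main.v *)
Require Import Defs.
From mathcomp Require Import measurable_realfun ring lra.

(** Away from a null set, N is a nondecreasing, right-constant, nat-valued path,
and then every time s has a neighbourhood on each side on which the risk process
rises with slope c; such paths are called sawtooth here.  Completeness of the
reals turns this local description into an induction principle
([sawtooth_ind]): a property that holds at time 0 and is carried from s to u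
whenever the path has slope c on [s, u[ holds at all times.

Along one linear piece everything is explicit.  If b = f s + c (u - s) is the
left limit of f at u, then

  c (L_u(y) - L_s(y)) = 1/2 1{y = f s} + 1{f s < y < b} + 1/2 1{y = f u}

([local_time_step]), because the jump subtracted at u replaces 1{f u > y} by
1{b > y}.  The three assertions are obtained by summing this identity.

(a) The right-hand side is nonnegative, and L_0 = 0.

(b) On ]s, u[ the level y is visited once if f s < y < b and never otherwise, so
c L_t(y) counts the visits to y during ]0, t[, plus one half for each of the two
end points ([local_time_visits]).  A visit is a crossing unless the path has
just jumped onto y ([crossing_level]), and almost surely it never does
([ae_no_jump_onto_level]): at a jump time s with N_s = m + 1, s is the first
passage time of N at m + 1, so X_s = x says that R_1 + ... + R_{m+1} takes a
value which is determined by N; that sum has no atoms and is independent of N,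
hence the event is null ([atomless_indep_neq]).

(c) For almost all y the right-hand side is the indicator of [f s, b[, so the
identity for one piece is the change of variables y = f s + c (r - s)
([integral_affine]), and [occupation_formula] adds the pieces up. *)

Set Implicit Arguments.
Unset Strict Implicit.
Unset Printing Implicit Defensive.

Local Open Scope classical_set_scope.
Local Open Scope ring_scope.

(** * Sawtooth paths *)

Section sawtooth.
Context {R : realType}.
Implicit Types (c s t u x y : R) (f : R -> R).

Definition linear_between c f s u :=
  forall r, s <= r < u -> f r = f s + c * (r - s).

Definition sawtooth c f :=
  (forall s, 0 <= s -> exists2 u, s < u & linear_between c f s u) /\
  (forall s, 0 < s -> exists2 r, 0 <= r < s & linear_between c f r s).

Lemma sub_linear_between c f s u s' u' : s <= s' -> s' < u -> u' <= u ->
  linear_between c f s u -> linear_between c f s' u'.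
Proof.
move=> ss' s'u u'u lin r /andP[s'r ru'].
rewrite (lin r) 1?(lin s'); first by lra.
- by rewrite ss' (lt_le_trans s'u).
- by rewrite (le_trans ss')//= (lt_le_trans ru').
Qed.

(** Real induction: consider the infimum m of the times where Q fails.  The
piece ending at m carries Q up to m, and the piece starting at m carries it
beyond m. *)
Lemma sawtooth_ind c f (Q : R -> Prop) : sawtooth c f -> Q 0 ->
  (forall s u, 0 <= s -> s < u -> linear_between c f s u -> Q s -> Q u) ->
  forall t, 0 <= t -> Q t.
Proof.
move=> [lin_right lin_left] Q0 Qstep t t0; apply: contrapT => nQt.
pose E := [set r | 0 <= r /\ ~ Q r].
have Et : E t by [].
have infE : has_inf E by split; [exists t|exists 0 => r []].
pose m := inf E.
have m0 : 0 <= m by apply: lb_le_inf; [exists t|move=> r []].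
have Qlt r : 0 <= r -> r < m -> Q r.
  move=> r0 rm; apply: contrapT => nQr.
  by have := ge_inf infE.2 (conj r0 nQr); rewrite leNgt rm.
have Qm : Q m.
  have [<-//|m_neq0] := eqVneq 0 m.
  have m_gt0 : 0 < m by rewrite lt_neqAle m_neq0.
  have [r /andP[r0 rm] lin] := lin_left _ m_gt0.
  by apply: (Qstep r m) => //; exact: Qlt.
have [u mu lin] := lin_right _ m0.
have [r [r0 nQr] ru] := inf_lt infE.1 mu.
apply: nQr; have [rm|mr|->//] := ltgtP r m; first exact: Qlt.
apply: (Qstep m r) => //; apply: sub_linear_between lin => //; exact: ltW.
Qed.

Lemma left_limit_linear c f s u : s < u -> linear_between c f s u ->
  left_limit f u = f s + c * (u - s).
Proof.
move=> su lin; apply: cvg_lim => //.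
have lincvg :
    (fun r => f s + c * (r - s)) r @[r --> u^'-] --> f s + c * (u - s).
  apply: cvg_at_left_filter.
  by apply: cvgD; [exact: cvg_cst|apply: cvgM; [exact: cvg_cst|
    apply: cvgB; [exact: cvg_id|exact: cvg_cst]]].
apply: cvg_trans lincvg; apply: near_eq_cvg; near=> r.
rewrite (lin r)//; apply/andP; split; near: r.
- exact: nbhs_left_ge.
- exact: nbhs_left_lt.
Unshelve. all: by end_near. Qed.

(** * The local time along one linear piece *)

Definition level_jump f y s : R :=
  \1_`]y, +oo[ (f s) - \1_`]y, +oo[ (left_limit f s).

Lemma indic_above y z : \1_`]y, +oo[ z = (y < z)%R%:R :> R.
Proof. by rewrite indicE mem_setE in_itv/= andbT. Qed.

Lemma indic_open (a b z : R) : \1_`]a, b[ z = (a < z < b)%R%:R :> R.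
Proof. by rewrite indicE mem_setE in_itv. Qed.

Lemma indic_level (y z : R) : \1_[set y] z = (z == y)%:R :> R.
Proof.
rewrite indicE; congr _%:R.
by congr nat_of_bool; apply/idP/eqP => [/set_mem//|->]; exact/mem_set.
Qed.

Lemma level_jump_linear c f y s u r : linear_between c f s u ->
  s < r < u -> level_jump f y r = 0.
Proof.
move=> lin /andP[sr ru]; rewrite /level_jump.
rewrite (@left_limit_linear c f s r)//; last first.
  by apply: sub_linear_between lin => //; [exact: lt_trans ru|exact: ltW].
by rewrite -lin ?subrr// (ltW sr).
Qed.

Definition level_jumps f y t := [set r | 0 < r <= t /\ level_jump f y r != 0].

(** The finite-support sum defining the local time is 0 by convention when the
support is infinite, so finiteness of the support is carried along with the
value of the sum. *)
Lemma sum_level_jump_step c f y s u : 0 <= s -> s < u ->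
  linear_between c f s u -> finite_set (level_jumps f y s) ->
  finite_set (level_jumps f y u) /\
  \sum_(r \in `]0, u]) level_jump f y r =
  \sum_(r \in `]0, s]) level_jump f y r + level_jump f y u.
Proof.
move=> s0 su lin fin.
have sumE v : \sum_(r \in `]0, v]) level_jump f y r =
    \sum_(r \in level_jumps f y v) level_jump f y r.
  apply/esym; apply: fsbig_widen => r; first by move=> [r0 _]; rewrite /= in_itv.
  rewrite /= in_itv/= => -[r0 nr]; apply: contrapT => /eqP rn.
  by apply: nr.
have sub : level_jumps f y u `<=` level_jumps f y s `|` [set u].
  move=> r [/andP[r0 ru] rn]; have [->|ru'] := eqVneq r u; first by right.
  left; split=> //; rewrite r0/= leNgt; apply/negP => sr.
  move: rn; rewrite (level_jump_linear _ lin) ?eqxx// sr/=.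
  by rewrite lt_neqAle ru'.
have finu : finite_set (level_jumps f y s `|` [set u]).
  by rewrite finite_setU; split.
split; first exact: sub_finite_set sub finu.
rewrite !sumE (fsbig_widen _ _ _ sub); last first.
  move=> r /= [[[/andP[r0 rs] rn]|->] nr]; apply: contrapT => /eqP rn'.
    by apply: nr; split => //; rewrite r0 (le_trans rs (ltW su)).
  by apply: nr; split => //; rewrite lexx (le_lt_trans s0 su).
rewrite fsbigU0//; first by rewrite fsbig_set1.
by move=> r [[/andP[_ rs] _] /= ru]; move: rs; rewrite ru leNgt su.
Qed.

Lemma finite_level_jumps c f y t : sawtooth c f -> 0 <= t ->
  finite_set (level_jumps f y t).
Proof.
move=> saw; move: t; apply: (sawtooth_ind saw).
  rewrite (_ : level_jumps _ _ _ = set0)// -subset0 => r [/andP[r0]].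
  by rewrite leNgt r0.
by move=> s u s0 su lin fin; have [] := sum_level_jump_step s0 su lin fin.
Qed.

(** Before the jump at u is subtracted, c L grows by the increase of
1/2 1{f = y} + 1{f > y} between s and u; the subtraction replaces the value
1{f u > y} by its left limit, as if the path had followed its slope up to u. *)
Lemma local_time_step c f x0 y s u : 0 < c -> sawtooth c f ->
  0 <= s -> s < u -> linear_between c f s u ->
  local_time x0 c f u y = local_time x0 c f s y +
    c^-1 * (2^-1 * \1_[set f s] y + \1_`]f s, f s + c * (u - s)[ y
            + 2^-1 * \1_[set f u] y).
Proof.
move=> c0 saw s0 su lin; rewrite /local_time -mulrDr; congr (_ * _).
have [_] := sum_level_jump_step s0 su lin (finite_level_jumps y saw s0).
rewrite /level_jump => ->; rewrite (left_limit_linear su lin).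
set S := \sum_(_ \in _) _; rewrite !indic_above !indic_level indic_open !(eq_sym y).
have : f s < f s + c * (u - s) by rewrite ltrDl mulr_gt0// subr_gt0.
set b := f s + _.
case: (ltgtP (f s) y) => //=; case: (ltgtP y b) => //=;
  case: (y < f u) => //=; case: eqP => //=;
  rewrite -?[true%:R]/1 -?[false%:R]/0; lra.
Qed.

Lemma local_time0 c f : local_time (f 0) c f 0 = cst 0.
Proof.
apply/funext => y; rewrite /local_time set_itvoc0 fsbig_set0.
by rewrite (_ : _ - _ - _ - _ = 0) ?mulr0//; ring.
Qed.

Lemma local_time_nondecreasing c f y s u : 0 < c -> sawtooth c f ->
  0 <= s -> s <= u -> local_time (f 0) c f s y <= local_time (f 0) c f u y.
Proof.
move=> c0 saw; have step r v : 0 <= r -> r < v -> linear_between c f r v ->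
    local_time (f 0) c f r y <= local_time (f 0) c f v y.
  move=> r0 rv lin; rewrite (local_time_step _ _ c0 saw r0 rv lin) lerDl.
  apply: mulr_ge0; first by rewrite invr_ge0 ltW.
  by rewrite !addr_ge0// mulr_ge0// invr_ge0.
move=> s0 su; have u0 := le_trans s0 su; move: u u0 s s0 su.
apply: (sawtooth_ind saw) => [s s0 su|r v r0 rv lin IH s s0 sv].
  by have -> : s = 0 by apply/eqP; rewrite eq_le su.
have [sr|rs] := leP s r.
  by apply: le_trans (IH _ s0 sr) _; exact: step.
have [->//|sv'] := eqVneq s v.
apply: step => //; first by rewrite lt_neqAle sv'.
by apply: sub_linear_between lin => //; [exact: ltW|rewrite lt_neqAle sv'].
Qed.


(** Where f is continuous with slope c, its values near s fill an open interval
around f s.  At a jump they fill ]l - eps, l[ and [f s, f s + eps[, l being the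
left limit; x is then not interior to their union, provided that x differs from
f s: if x = l, the levels just above x are missed. *)
Lemma crossing_level c f x s : 0 < c -> sawtooth c f -> 0 < s ->
  (f s = x -> left_limit f s = f s) -> crossing f x s <-> f s = x.
Proof.
move=> c0 [lin_right lin_left] s0 nojump.
have [u su linr] := lin_right _ (ltW s0).
have [v /andP[v0 vs] linl] := lin_left _ s0.
have limE := left_limit_linear vs linl.
have linl' r : v <= r < s -> f r = left_limit f s + c * (r - s).
  by move=> /linl ->; rewrite limE; ring.
split=> [[_ cross]|fsx].
  apply: contrapT => /eqP fsx.
  pose l := left_limit f s.
  pose gap := if x < l then l - x else 1.
  have gap0 : 0 < gap by rewrite /gap; case: ifPn; rewrite ?subr_gt0.
  (* A level x + h with small h > 0 is missed: it is too far from f s, and it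
     lies above l when l <= x, and too far below l when x < l. *)
  pose a := Num.min gap `|x - f s|.
  have a0 : 0 < a by rewrite lt_min gap0 normr_gt0 subr_eq0 eq_sym.
  have [agap afs] : a <= gap /\ a <= `|x - f s|.
    by split; rewrite ge_min lexx ?orbT.
  pose e := Num.min (a / (2 * c)) (Num.min (s - v) (u - s)).
  have e0 : 0 < e by rewrite !lt_min divr_gt0 ?mulr_gt0//= !subr_gt0 vs.
  have [ea ev eu] : [/\ 2 * (c * e) <= a, e <= s - v & e <= u - s].
    split; [|by rewrite !ge_min lexx !orbT|by rewrite !ge_min lexx !orbT].
    by rewrite mulrA -ler_pdivlMl ?mulr_gt0// mulrC ge_min lexx.
  clearbody e.
  have se : s \in `]s - e, s + e[ by rewrite in_itv/= ltrBlDr !ltrDl e0.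
  have := cross `]s - e, s + e[ (itv_open _ _) se.
  rewrite /interior/= => /nbhs_ballP[d /= d0 sub].
  pose h := Num.min (d / 2) (c * e).
  have h0 : 0 < h by rewrite lt_min divr_gt0//= mulr_gt0.
  have hd : h < d by rewrite gt_min ltr_pdivrMr// ltr_pMr// ltr1n.
  have he : h <= c * e by rewrite ge_min lexx orbT.
  clearbody h.
  have : ball x d (x + h).
    by rewrite /ball/= opprD addNKr normrN gtr0_norm.
  move=> /sub[r [/=]]; rewrite in_itv/= => /andP[ser rse] r0.
  have [rs|sr] := ltP r s.
    rewrite linl' -/l; last by rewrite rs andbT; lra.
    have : c * (s - r) < c * e by rewrite ltr_pM2l//; lra.
    have : 0 < c * (s - r) by rewrite mulr_gt0// subr_gt0.
    move: agap; rewrite /gap; case: ltP; lra.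
  rewrite linr; last by rewrite sr; lra.
  have : c * (r - s) < c * e by rewrite ltr_pM2l//; lra.
  have : 0 <= c * (r - s) by rewrite mulr_ge0 ?subr_ge0// ltW.
  move: afs; case: (ger0P (x - f s)); lra.
split=> // I /= openI sI.
have [e /= e0 sub] : nbhs s [set` I] by exact: open_nbhs_nbhs.
pose d := Num.min e (Num.min (s - v) (u - s)).
have d0 : 0 < d by rewrite !lt_min e0/= !subr_gt0 vs.
have [de dv du] : [/\ d <= e, d <= s - v & d <= u - s].
  by split; rewrite !ge_min lexx ?orbT.
clearbody d.
apply/nbhs_ballP; exists (c * d) => /=; first exact: mulr_gt0.
move=> y; rewrite /ball/= ltr_norml => /andP[y1 y2].
pose z := (y - x) / c.
have zc : c * z = y - x by rewrite mulrCA divff ?mulr1// gt_eqF.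
clearbody z.
have szc : c * (s + z - s) = y - x by rewrite addrAC subrr add0r.
have z1 : - d < z by rewrite -(ltr_pM2l c0) zc; lra.
have z2 : z < d by rewrite -(ltr_pM2l c0) zc; lra.
exists (s + z); first split => /=.
- apply: sub; rewrite /ball/= opprD addNKr normrN ltr_norml; lra.
- by lra.
- have [zs|sz] := ltP z 0.
    rewrite linl'; last by lra.
    by rewrite nojump// fsx szc; ring.
  by rewrite linr ?fsx ?szc; [ring|lra].
Qed.

End sawtooth.

(** * Affine change of variables *)

Section affine.
Context {R : realType}.
Implicit Types (c a : R).
Local Notation lambda := (@lebesgue_measure R).

Definition affine c a : measurableTypeR R -> measurableTypeR R :=
  fun r => a + c * r.

Lemma measurable_affine c a : measurable_fun setT (affine c a).
Proof. by apply: measurable_funD => //; exact: measurable_funM. Qed.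

(** Both sides are measures that agree on half-open intervals. *)
Lemma lebesgue_measure_affine c a (A : set R) : 0 < c -> measurable A ->
  lambda A = (c%:E * lambda (affine c a @^-1` A))%E.
Proof.
move=> c0 mA.
apply: (@lebesgue_measure_unique _
  (mscale (NngNum (ltW c0)) (pushforward lambda (affine c a)))) => //.
  exact: measurable_affine.
move=> mphi _ [[y z]] _ <- /=; rewrite /mscale/= /pushforward.
have -> : affine c a @^-1` `]y, z] = `](y - a) / c, (z - a) / c]%classic.
  apply/seteqP; split=> r; rewrite /= /affine !in_itv/=;
    by rewrite ltr_pdivrMr// ler_pdivlMr// ltrBlDl lerBrDl mulrC.
rewrite lebesgue_measure_itv lebesgue_measure_itv/= !lte_fin.
rewrite ltr_pM2r ?invr_gt0// ltrD2r.
case: ifPn; rewrite ?mule0// => yz.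
by rewrite -!EFinB -EFinM; congr EFin; field; rewrite gt_eqF.
Qed.

Lemma ge0_integral_affine c a (D : set R) (h : R -> \bar R) : 0 < c ->
  measurable D -> measurable_fun setT h -> (forall y, 0 <= h y)%E ->
  (\int[lambda]_(y in D) h y =
   c%:E * \int[lambda]_(r in affine c a @^-1` D) h (affine c a r))%E.
Proof.
move=> c0 mD mh h0.
have mhD : measurable_fun D h by exact: measurable_funTS.
rewrite -(@ge0_integral_pushforward _ _ _ _ _ _ (measurable_affine c a) lambda D h)//.
rewrite -[X in (X * _)%E]/((NngNum (ltW c0))%:num%:E) -ge0_integral_mscale//.
  exact: measurable_affine.
move=> mphi; apply: eq_measure_integral => A mA _.
exact: lebesgue_measure_affine.
Qed.

Lemma integral_affine c a (D : set R) (h : R -> \bar R) : 0 < c ->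
  measurable D -> measurable_fun setT h -> lambda.-integrable D h ->
  (\int[lambda]_(r in affine c a @^-1` D) h (affine c a r) =
   c^-1%:E * \int[lambda]_(y in D) h y)%E.
Proof.
move=> c0 mD mh ih.
have ge0_case k : measurable_fun setT k -> (forall y, 0 <= k y)%E ->
    (\int[lambda]_(r in affine c a @^-1` D) k (affine c a r) =
     c^-1%:E * \int[lambda]_(y in D) k y)%E.
  move=> mk k0; rewrite (ge0_integral_affine a c0 mD mk k0) muleA -EFinM.
  by rewrite mulVf ?gt_eqF// mul1e.
rewrite [LHS]integralE [in RHS]integralE muleBr//; last first.
  by apply: fin_num_adde_defr; exact: integrable_pos_fin_num.
have mp : measurable_fun setT h^\+%E by exact: measurable_funepos.
have mn : measurable_fun setT h^\-%E by exact: measurable_funeneg.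
rewrite -(ge0_case _ mp); last by move=> y; exact: funepos_ge0.
rewrite -(ge0_case _ mn); last by move=> y; exact: funeneg_ge0.
by congr (_ - _)%E; apply: eq_integral => r _; rewrite ?funeposE ?funenegE.
Qed.

End affine.

(** * The occupation formula *)

Section occupation.
Context {R : realType}.
Local Notation lambda := (@lebesgue_measure R).
Variables (c : R) (f g : R -> R).
Hypotheses (c0 : 0 < c) (saw : sawtooth c f).
Hypotheses (mg : measurable_fun setT g) (bg : exists M, forall y, `|g y| <= M).

Lemma bounded_on (D : set R) : [bounded g y | y in D].
Proof.
have [M gM] := bg; exists M; split; first exact: num_real.
by move=> N MN y _; exact: le_trans (gM y) (ltW MN).
Qed.

Lemma integrable_on_itv (a b : R) : lambda.-integrable `[a, b[ (EFin \o g).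
Proof.
apply: measurable_bounded_integrable => //=.
- by rewrite lebesgue_measure_itv/=; case: ifPn => // _; rewrite -EFinB ltry.
- exact: measurable_funTS.
- exact: bounded_on.
Qed.

Lemma integral_linear_piece (s u : R) : s < u -> linear_between c f s u ->
  measurable_fun `[s, u[ (g \o f) /\
  (\int[lambda]_(r in `[s, u[) (g (f r))%:E =
   c^-1%:E * \int[lambda]_(y in `[f s, (f s + c * (u - s))%R[) (g y)%:E)%E.
Proof.
move=> su lin; pose a := f s - c * s.
have faff r : r \in `[s, u[ -> f r = affine c a r.
  by rewrite in_itv => /lin ->; rewrite /affine/a; ring.
have pre : `[s, u[%classic = affine c a @^-1` `[f s, (f s + c * (u - s))%R[.
  apply/seteqP; split=> r; rewrite /= !in_itv/= /affine/a => /andP[r1 r2].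
    have : c * s <= c * r by rewrite ler_pM2l.
    have : c * r < c * u by rewrite ltr_pM2l.
    lra.
  rewrite -(ler_pM2l c0) -[X in _ && X](ltr_pM2l c0); lra.
split.
  apply: (@eq_measurable_fun _ _ _ _ _ (g \o affine c a)).
    by move=> r /set_mem/= /faff ->.
  apply: measurable_funTS; apply: measurableT_comp => //.
  exact: measurable_affine.
rewrite -(integral_affine (c := c) a)//; first last.
- exact: integrable_on_itv.
- exact/measurable_EFinP.
rewrite -pre; apply: eq_integral => r /set_mem/= /faff ->//.
Qed.


Definition level_increment (s u y : R) : R :=
  c^-1 * (2^-1 * \1_[set f s] y + \1_`]f s, f s + c * (u - s)[ y
          + 2^-1 * \1_[set f u] y).

Lemma integrable_level_increment s u :
  lambda.-integrable setT (EFin \o level_increment s u).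
Proof.
have i1 (a : R) : lambda.-integrable setT (EFin \o \1_[set a]).
  by rewrite -set_itv1; exact: integrable_indic_itv.
have i2 := integrable_indic_itv (f s) (f s + c * (u - s)) false true.
rewrite (_ : EFin \o _ = (fun y => c^-1%:E * ((2^-1%:E * (\1_[set f s] y)%:E +
   (\1_`]f s, f s + c * (u - s)[ y)%:E) + 2^-1%:E * (\1_[set f u] y)%:E))%E)//.
apply: integrableZl => //.
apply: integrableD => //; last exact: (integrableZl _ _ (i1 (f u))).
by apply: integrableD => //; exact: (integrableZl _ _ (i1 (f s))).
Qed.

(** The points f s and f u form a null set, outside of which the increment is
c^-1 times the indicator of [f s, f s + c (u - s)[. *)
Lemma integral_level_increment s u : s < u -> 
  (\int[lambda]_y (g y * level_increment s u y)%:E =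
   c^-1%:E * \int[lambda]_(y in `[f s, (f s + c * (u - s))%R[) (g y)%:E)%E.
Proof.
move=> su; pose b := f s + c * (u - s).
have sb : f s < b by rewrite ltrDl mulr_gt0// subr_gt0.
rewrite [X in (_ * X)%E]integral_mkcond -integralZl//; last first.
  by apply: (integrable_mkcond _ _).1 => //; exact: integrable_on_itv.
apply: ae_eq_integral => //.
- apply/measurable_EFinP; apply: measurable_funM => //; apply/measurable_EFinP.
  exact: (measurable_int _ (integrable_level_increment s u)).
- apply: emeasurable_funM => //; apply/measurable_restrict => //.
  by rewrite setTI; apply/measurable_EFinP; exact: measurable_funTS.
- exists ([set f s] `|` [set f u]); split.
  + exact: measurableU.
  + apply: measure_negligible; first exact: measurableU.
    by apply: negligibleU; apply/negligibleP => //; exact: lebesgue_measure_set1.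
  + move=> y /= nE; apply: contrapT => /not_orP[/eqP ys /eqP yu]; apply: nE => _.
    rewrite /level_increment !indic_level indic_open (negbTE ys) (negbTE yu).
    rewrite patchE mem_setE in_itv/= le_eqVlt eq_sym (negbTE ys)/= -/b.
    by case: (f s < y < b) => /=; rewrite ?mule0 -?EFinM; congr EFin; ring.
Qed.

Lemma occupation_formula t : 0 <= t ->
  (\int[lambda]_(s in `[0%R, t]) (g (f s))%:E =
   \int[lambda]_y (g y * local_time (f 0) c f t y)%:E)%E.
Proof.
move=> t0.
(* The induction runs on [0, t[, so that consecutive pieces are disjoint; the
   added integrability makes the integrals additive. *)
suff [mgf _ <-] : [/\ measurable_fun `[0, t[ (g \o f),
    lambda.-integrable setT (fun y => (g y * local_time (f 0) c f t y)%:E) &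
    (\int[lambda]_(s in `[0%R, t[) (g (f s))%:E =
    \int[lambda]_y (g y * local_time (f 0) c f t y)%:E)%E].
  by apply/esym/integral_itv_bndo_bndc; exact/measurable_EFinP.
move: t t0; apply: (sawtooth_ind saw) => [|s u s0 su lin [mgf iL IH]].
  rewrite local_time0 set_itvco0; split.
  - exact: measurable_fun_set0.
  - by under eq_fun do rewrite mulr0; exact: integrable0.
  - by rewrite integral_set0; under eq_integral do rewrite mulr0; rewrite integral0.
have [mgp Ep] := integral_linear_piece su lin.
have -> : `[0, u[%classic = `[0, s[ `|` `[s, u[.
  by rewrite -itv_bndbnd_setU// bnd_simp ltW.
have LE : (fun y => (g y * local_time (f 0) c f u y)%:E) =
    (fun y => (g y * local_time (f 0) c f s y)%:E +
              (g y * level_increment s u y)%:E)%E.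
  apply/funext => y; rewrite (local_time_step _ y c0 saw s0 su lin).
  by rewrite -EFinD mulrDr.
have ii : lambda.-integrable setT (fun y => (g y * level_increment s u y)%:E).
  have mgR : measurable_fun [set: measurableTypeR R] g by exact: mg.
  have := integrableMr measurableT mgR (bounded_on setT)
    (integrable_level_increment s u).
  by congr (_.-integrable _ _); apply/funext => y; rewrite EFinM.
have mU : measurable_fun (`[0, s[ `|` `[s, u[) (g \o f).
  by apply/measurable_funU => //.
split; [exact: mU|by rewrite LE; exact: integrableD|].
rewrite integral_setU; first last.
- apply/disj_set2P; rewrite -subset0 => r [/=]; rewrite !in_itv/=.
  by move=> /andP[_ rs] /andP[]; rewrite leNgt rs.
- exact/measurable_EFinP.
- exact: measurable_itv.
- exact: measurable_itv.
rewrite LE integralD; [|by []|exact: iL|exact: ii].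
by rewrite IH integral_level_increment// Ep.
Qed.

End occupation.

(** * Visits and crossings *)

Section visits.
Context {R : realType}.
Implicit Types (c s t u x y : R) (f : R -> R).

Definition visits f x t := [set r | 0 < r < t /\ f r = x].

(** The new visits lie in [s, u[, where f is injective: the only candidate is
the solution p of f s + c (p - s) = x.  Time s itself counts as a new visit only
if s > 0, the visits being those during the open interval ]0, u[. *)
Lemma visits_step c f x s u : 0 < c -> 0 <= s -> s < u ->
  linear_between c f s u -> finite_set (visits f x s) ->
  finite_set (visits f x u) /\
  \sum_(r \in visits f x u) (1 : R) = \sum_(r \in visits f x s) (1 : R) +
    (((0 < s) && (f s == x)) + (f s < x < f s + c * (u - s))%R)%:R.
Proof.
move=> c0 s0 su lin fin; pose b := f s + c * (u - s).
pose p := s + (x - f s) / c.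
pose V := [set r | r = p /\ ((0 < s) && (f s == x) || (f s < x < b))].
have cp : c * (p - s) = x - f s.
  by rewrite /p addrAC subrr add0r mulrC divfK// gt_eqF.
have sb : f s < b by rewrite ltrDl mulr_gt0// subr_gt0.
have E : visits f x u = visits f x s `|` V.
  apply/seteqP; split=> r /=.
    move=> [/andP[r0 ru] frx]; have [rs|sr] := ltP r s.
      by left; split=> //; rewrite r0.
    right; have fr := lin r; rewrite sr ru frx in fr.
    have {}fr := fr isT.
    have rp : r = p.
      by apply: (mulfI (lt0r_neq0 c0)); move: cp fr; lra.
    split=> //.
    move: sr; rewrite le_eqVlt => /predU1P[sr|sr].
      by apply/orP; left; rewrite sr r0 frx eqxx.
    apply/orP; right; rewrite /b fr; apply/andP; split.
      by rewrite ltrDl mulr_gt0// subr_gt0.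
    by rewrite ltrD2l ltr_pM2l// ltrD2r.
  move=> [[/andP[r0 rs] frx]|[-> /orP[/andP[s1 /eqP fsx]|/andP[x1 x2]]]].
  - by split=> //; rewrite r0 (lt_trans rs su).
  - have -> : p = s by rewrite /p fsx subrr mul0r addr0.
    by split=> //; rewrite s1 su.
  - have sp : s < p by rewrite ltrDl divr_gt0// subr_gt0.
    have pu : p < u.
      by rewrite -(ltrD2r (- s)) -(ltr_pM2l c0) cp ltrBlDl.
    split; first by rewrite (le_lt_trans s0 sp) pu.
    by rewrite (lin p) ?cp ?(ltW sp)//; ring.
have VE : V = if (0 < s) && (f s == x) || (f s < x < b) then [set p] else set0.
  by apply/seteqP; split=> r; rewrite /V; case: ifPn => //= _ []//.
have finV : finite_set V by rewrite VE; case: ifPn.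
split; first by rewrite E finite_setU; split.
rewrite E fsbigU0//; last first.
  move=> r [[/andP[_ rs] _] [rp]]; move: rs; rewrite rp.
  move=> ps /orP[/andP[_ /eqP fsx]|/andP[x1 _]].
    by move: ps; rewrite /p fsx subrr mul0r addr0 ltxx.
  by move: ps; rewrite ltNge lerDl divr_ge0 ?subr_ge0// ltW.
congr (_ + _); rewrite VE -/b.
case: (ltgtP (f s) x) => /= _; rewrite ?andbF ?andbT ?orbF ?addn0 ?add0n /=.
- by case: ifPn; rewrite ?fsbig_set1 ?fsbig_set0.
- by rewrite fsbig_set0.
- by case: ifPn; rewrite ?fsbig_set1 ?fsbig_set0.
Qed.

Lemma finite_visits c f x t : 0 < c -> sawtooth c f -> 0 <= t ->
  finite_set (visits f x t).
Proof.
move=> c0 saw; move: t; apply: (sawtooth_ind saw) => [|s u s0 su lin fin].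
  rewrite (_ : visits _ _ _ = set0)// -subset0 => r [/andP[r0 /(lt_trans r0)]].
  by rewrite ltxx.
by have [] := visits_step c0 s0 su lin fin.
Qed.

(** A visit at an end point s > 0 of a piece receives one half from each of the
two adjacent pieces; times 0 and t have only one adjacent piece. *)
Lemma local_time_visits c f x t : 0 < c -> sawtooth c f -> 0 < t ->
  local_time (f 0) c f t x = c^-1 * (2^-1 * \1_[set f t] x
    + 2^-1 * \1_[set f 0] x + \sum_(r \in visits f x t) (1 : R)).
Proof.
move=> c0 saw t0; move: (ltW t0) (t0); move: t {t0}.
apply: (sawtooth_ind saw) => [|s u s0 su lin IH _]; first by rewrite ltxx.
have [_ ->] := visits_step c0 s0 su lin (finite_visits x c0 saw s0).
rewrite (local_time_step _ x c0 saw s0 su lin).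
move: s0; rewrite le_eqVlt => /predU1P[s0|s0].
  subst s; rewrite ltxx/= add0n local_time0 indic_open.
  rewrite (_ : visits f x 0 = set0) ?fsbig_set0; first by rewrite /cst; ring.
  by rewrite -subset0 => r [/andP[r0 /(lt_trans r0)]]; rewrite ltxx.
rewrite (IH s0) s0/= natrD indic_open !(indic_level (f s)) (eq_sym x).
by field; rewrite gt_eqF.
Qed.

Lemma counting_sum (S : set R) : finite_set S ->
  counting S = (\sum_(r \in S) (1 : R))%:E :> \bar R.
Proof.
move=> finS; rewrite /counting asboolT// fsbig_finite//=.
by rewrite big_const_seq count_predT iter_addr_0.
Qed.

Lemma local_time_crossings c f x t : 0 < c -> sawtooth c f -> 0 < t ->
  (forall s, 0 < s -> f s = x -> left_limit f s = f s) ->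
  ((local_time (f 0) c f t x)%:E = (c^-1)%:E * ((2^-1 * \1_[set f t] x)%:E
    + (2^-1 * \1_[set f 0] x)%:E + crossings f t x))%E.
Proof.
move=> c0 saw t0 nojump; rewrite local_time_visits//.
rewrite /crossings (_ : [set _ | _] = visits f x t).
  by rewrite counting_sum ?EFinM ?EFinD//; exact: finite_visits saw (ltW t0).
apply/seteqP; split=> s /= [s0t]; have /andP[s0 _] := s0t;
  by rewrite (crossing_level c0 saw s0 (nojump s s0)).
Qed.

End visits.

Lemma measurable_eq_set d (T : measurableType d) (R : realType) (V U : T -> R) :
  measurable_fun setT V -> measurable_fun setT U ->
  measurable [set w | V w = U w].
Proof.
move=> mV mU.
rewrite (_ : [set _ | _] = ~` (setT `&` [set w | (V w)%:E != (U w)%:E])).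
  by apply: measurableC; apply: measurable_neqe => //; exact/measurable_EFinP.
rewrite setTI; apply/seteqP; split=> w /=; first by move=> ->; rewrite eqxx.
by move/negP; rewrite negbK => /eqP[].
Qed.

(** * Independence and atoms *)

Section independence.
Context d (Omega : measurableType d) (R : realType) (P : probability Omega R).

Definition atomless (U : Omega -> R) := forall a, P (U @^-1` [set a]) = 0%E.

(** Under independence the joint law of V and U is the product of their laws,
and the sections of the diagonal are singletons, which the law of U does not
charge. *)
Lemma atomless_indep_neq (U V : Omega -> R) :
  measurable_fun setT U -> measurable_fun setT V -> atomless U ->
  (forall A B, measurable A -> measurable B ->
    P (V @^-1` A `&` U @^-1` B) = (P (V @^-1` A) * P (U @^-1` B))%E) ->
  P [set w | V w = U w] = 0%E.
Proof.
move=> mU mV Ua indep.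
have mVU : measurable_fun setT (fun w => (V w, U w)) by exact: measurable_fun_pair.
pose lawV := distribution P (mfun_Sub (mem_set mV)).
pose lawU := distribution P (mfun_Sub (mem_set mU)).
have := @product_measure_unique _ _ _ _ R lawV lawU
  (pushforward P (fun w => (V w, U w))).
move=> /(_ mVU) uniqm.
transitivity (pushforward P (fun w => (V w, U w))
  [set vu : R * R | vu.1 = vu.2]) => //.
rewrite -uniqm; first last.
- exact: measurable_eq_set.
- by move=> A B mA mB; exact: indep.
rewrite /product_measure1; under eq_integral => v _.
  rewrite /= (_ : xsection _ v = [set v]).
    rewrite /lawU /distribution /pushforward Ua; over.
  by apply/seteqP; split=> u; rewrite xsectionE /=.
by rewrite integral0.
Qed.

Lemma generated_sigma_algebra_measurable d' (T : measurableType d') (I : Type)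
  (D : set I) (Y : I -> {RV P >-> T}) :
  generated_sigma_algebra D (fun i => Y i : Omega -> T) `<=` measurable.
Proof.
apply: smallest_sub; first exact: sigma_algebra_measurable.
by move=> _ [i Di] [B mB] <-; exact: measurable_funP.
Qed.

(** The sets that are independent of Y n contain the cylinders over
Y 0, ..., Y (n-1), which are stable under intersection and generate the past;
uniqueness of finite measures extends the product rule from them. *)
Lemma indep_past d' (T : measurableType d') (Y : nat -> {RV P >-> T}) n A B :
  mutually_independent P (fun k => Y k : Omega -> T) ->
  generated_sigma_algebra [set k | (k < n)%N] (fun k => Y k : Omega -> T) A ->
  measurable B ->
  P (A `&` Y n @^-1` B) = (P A * P (Y n @^-1` B))%E.
Proof.
move=> indep GA mB.
pose E := Y n @^-1` B.
have mE : measurable E by rewrite -[E]setTI; exact: measurable_funP.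
pose cyl (C : nat -> set T) := \bigcap_(k in [set k | (k < n)%N]) Y k @^-1` C k.
pose G := [set A |
  exists2 C : nat -> set T, (forall k, measurable (C k)) & A = cyl C].
have mcyl C : (forall k, measurable (C k)) -> measurable (cyl C).
  move=> mC; apply: bigcap_measurableType => k _.
  by rewrite -[X in measurable X]setTI; exact: measurable_funP.
have Gm : G `<=` measurable by move=> _ [C mC ->]; exact: mcyl.
have GT : G setT.
  by exists (fun=> setT) => //; apply/esym; rewrite -subTset => w _ k.
have EfinE : P E = (fine (P E))%:E by rewrite fineK// fin_num_measure.
have fE0 : 0 <= fine (P E) by rewrite fine_ge0.
have mscaleE X : mscale (NngNum fE0) P X = (P E * P X)%E.
  by rewrite [in RHS]EfinE.
have GI : setI_closed G.
  move=> _ _ [C mC ->] [C' mC' ->]; exists (fun k => C k `&` C' k).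
    by move=> k; exact: measurableI.
  by rewrite /cyl -bigcapI; apply: eq_bigcapr => k _; rewrite preimage_setI.
have cylE (C : nat -> set T) m :
    \bigcap_(k in [set k | (k < m)%N]) Y k @^-1` C k =
    \bigcap_(k in [set` iota 0 m]) Y k @^-1` C k.
  by congr bigcap; apply/seteqP; split=> k /=; rewrite mem_iota.
suff : mrestr P mE A = mscale (NngNum fE0) P A.
  by move=> PA; rewrite [RHS]muleC -mscaleE -PA.
apply: (@g_sigma_algebra_measure_unique _ _ _ G Gm (fun=> setT)) => //.
- by rewrite bigcup_const//; exists 0%N.
- move=> _ [C mC ->]; 
  rewrite -[RHS]/(mscale (NngNum fE0) P (cyl C)) mscaleE /= /mrestr.
  pose C' k := if k == n then B else C k.
  have mC' k : measurable (C' k) by rewrite /C'; case: ifPn.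
  have -> : cyl C `&` E = \bigcap_(k in [set k | (k < n.+1)%N]) Y k @^-1` C' k.
    apply/seteqP; split=> w.
      move=> [wC wE] k; rewrite /= ltnS /C'; case: eqVneq => [-> //|kn kn'].
      by apply: wC; rewrite /= ltn_neqAle kn.
    move=> wC; split=> [k kn|]; last first.
      by have := wC n (ltnSn n); rewrite /C' eqxx.
    by have := wC k (ltnW kn); rewrite /C' ltn_eqF.
  rewrite cylE indep ?iota_uniq// /cyl cylE indep ?iota_uniq//.
  rewrite -addn1 iotaD big_cat/= big_seq1 add0n /C' eqxx muleC.
  congr (_ * _)%E; rewrite big_seq [RHS]big_seq; apply: eq_bigr => k.
  by rewrite mem_iota add0n => /andP[_ kn]; rewrite ltn_eqF.
- by move=> _; rewrite /= /mrestr setTI ltey_eq fin_num_measure.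
- move: A GA; apply: smallest_sub; first exact: smallest_sigma_algebra.
  move=> _ [k /= kn] [B' mB'] <-; apply: sub_sigma_algebra.
  exists (fun i => if i == k then B' else setT).
    by move=> i; case: ifPn.
  rewrite setTI; apply/seteqP; split=> w /=.
    by move=> wB i _ /=; case: eqVneq => [->|].
  by move=> /(_ k kn); rewrite /= eqxx.
Qed.

End independence.

(** * Counting paths *)

Section counting_paths.
Context {R : realType}.

Definition counting_path (n : R -> nat) :=
  (forall s u, 0 <= s -> s <= u -> (n s <= n u)%N) /\
  (forall s, 0 <= s -> \forall u \near s^'+, n u = n s).

(** On the left of s, n is constant from any time at which it takes its largest
value before s; this maximum exists because n is bounded by n s there. *)
Lemma sawtooth_counting_path (n : R -> nat) (a : nat -> R) (c : R) :
  counting_path n -> sawtooth c (fun s => a (n s) + c * s).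
Proof.
move=> [mono right]; split=> s s0.
  have := right s s0; rewrite near_withinE => /nbhs_ballP[e /= e0 near].
  exists (s + e) => [|r /andP[sr rse]]; first by rewrite ltrDl.
  have -> : n r = n s.
    move: sr; rewrite le_eqVlt => /predU1P[->//|sr].
    by apply: near => //; rewrite /ball/= distrC ger0_norm ?subr_ge0 ?ltW//; lra.
  by ring.
have bnd r : 0 <= r < s -> (n r <= n s)%N.
  by move=> /andP[r0 rs]; apply: mono => //; exact: ltW.
pose val m := `[< exists2 r, 0 <= r < s & n r = m >].
have exv : exists m, val m.
  by exists (n 0); apply/asboolP; exists 0; rewrite ?lexx.
have bndv m : val m -> (m <= n s)%N by move=> /asboolP[r rs <-]; exact: bnd.
case: (ex_maxnP exv bndv) => m /asboolP[r /andP[r0 rs] nr] maxm.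
exists r => [|v /andP[rv vs]]; first by rewrite r0.
have -> : n v = n r.
  apply/eqP; rewrite eqn_leq; apply/andP; split; last exact: mono.
  by rewrite nr maxm//; apply/asboolP; exists v; rewrite // (le_trans r0 rv).
by ring.
Qed.

Lemma counting_path_no_jump (n : R -> nat) (a : nat -> R) (c : R) r s :
  counting_path n -> 0 <= r < s -> n r = n s ->
  left_limit (fun v => a (n v) + c * v) s = a (n s) + c * s.
Proof.
move=> [mono _] /andP[r0 rs] nrs.
rewrite (@left_limit_linear _ c _ r) => [|//|v /andP[rv vs]].
  by rewrite nrs; ring.
have -> : n v = n r.
  apply/eqP; rewrite eqn_leq; apply/andP; split; last exact: mono.
  by rewrite nrs mono ?(le_trans r0)// ltW.
by ring.
Qed.

Definition nonneg_rat (k : nat) : R := `|ratr (odflt 0 (unpickle k))|.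

Lemma nonneg_rat_dense (a b : R) : 0 <= a -> a < b ->
  exists k, a < nonneg_rat k < b.
Proof.
move=> a0 ab; have [q] := rat_in_itvoo ab; rewrite in_itv/= => /andP[aq qb].
exists (pickle q); rewrite /nonneg_rat pickleK /= ger0_norm ?aq//.
by rewrite (le_trans a0)// ltW.
Qed.

(** The infimum runs over countably many times, which makes it measurable;
their density and the monotonicity of n make it the time of the jump onto m. *)
Definition first_passage (n : R -> nat) (m : nat) : \bar R :=
  einfs (fun k =>
    if (m <= n (nonneg_rat k))%N then (nonneg_rat k)%:E else +oo%E) 0%N.

Lemma first_passage_jump n s : counting_path n -> 0 <= s ->
  (forall r, 0 <= r < s -> (n r < n s)%N) -> first_passage n (n s) = s%:E.
Proof.
move=> [mono _] s0 jump; rewrite /first_passage /einfs/=.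
apply/eqP; rewrite eq_le; apply/andP; split.
  apply/lee_addgt0Pr => e e0.
  have se : s < s + e by rewrite ltrDl.
  have [k /andP[sk ke]] := nonneg_rat_dense s0 se.
  apply: ge_ereal_inf; exists (nonneg_rat k)%:E; last first.
    by rewrite -EFinD lee_fin ltW.
  by exists k => //; rewrite mono// ltW.
apply: le_ereal_inf_tmp => _ [k _ <-]; case: ifPn => [mk|_]; last exact: leey.
rewrite lee_fin leNgt; apply/negP => ks.
by move: mk; rewrite leqNgt jump// normr_ge0 ks.
Qed.

End counting_paths.

(** * The risk process almost surely does not jump onto a given level *)

Section no_jump.
Context d (Omega : measurableType d) (R : realType) (P : probability Omega R).

Lemma has_density_atomless (Y : {RV P >-> R}) : has_density Y -> atomless P Y.
Proof.
move=> [f [_ _ Yf]] a; have := Yf [set a] (measurable_set1 a).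
by rewrite /distribution /pushforward => ->; rewrite integral_set1.
Qed.

Lemma measurable_generated d' (T : measurableType d') (I : Type) (D : set I)
  (Y : I -> Omega -> T) i : D i ->
  measurable_fun (setT : set (g_sigma_algebraType
    (\bigcup_(i in D) preimage_set_system setT (Y i) measurable))) (Y i).
Proof.
by move=> Di _ B mB; apply: sub_sigma_algebra; exists i => //; exists B.
Qed.

Lemma partial_sum_generated (Z : nat -> Omega -> R) (D : set nat) n
    (B : set R) :
  (forall k, (k < n)%N -> D k) -> measurable B ->
  generated_sigma_algebra D Z ((fun w => \sum_(k < n) Z k w) @^-1` B).
Proof.
move=> nD mB; pose G := \bigcup_(i in D) preimage_set_system setT (Z i) measurable.
have mS : measurable_fun (setT : set (g_sigma_algebraType G))
    (fun w => \sum_(k < n) Z k w).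
  by apply: measurable_sum => k; apply: measurable_generated; exact: nD.
by rewrite -[X in generated_sigma_algebra _ _ X]setTI; exact: mS.
Qed.

Lemma first_passage_generated (N : R -> Omega -> nat) m (B : set R) :
  measurable B -> generated_sigma_algebra [set s : R | 0 <= s] N
    ((fun w => fine (first_passage (N^~ w) m)) @^-1` B).
Proof.
move=> mB; pose G := \bigcup_(s in [set s : R | 0 <= s])
  preimage_set_system setT (N s) measurable.
have mT : measurable_fun (setT : set (g_sigma_algebraType G))
    (fun w => fine (first_passage (N^~ w) m)).
  apply: measurableT_comp => //; apply: measurable_fun_einfs => k.
  apply: (measurableT_comp (f := fun i =>
    if (m <= i)%N then (nonneg_rat k)%:E else +oo%E)) => //.
  exact: (measurable_generated (i := nonneg_rat k) (normr_ge0 _)).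
by rewrite -[X in generated_sigma_algebra _ _ X]setTI; exact: mT.
Qed.

(** The last term is atomless and independent of the sum of the others. *)
Lemma partial_sum_atomless (Z : nat -> {RV P >-> R}) n :
  mutually_independent P (fun k => Z k : Omega -> R) ->
  (forall k, atomless P (Z k)) ->
  atomless P (fun w => \sum_(k < n.+1) Z k w).
Proof.
move=> indep Za a.
pose V w := a - \sum_(k < n) Z k w.
have mV : measurable_fun setT V.
  by apply: measurable_funB => //; exact: measurable_sum.
rewrite -(@atomless_indep_neq _ _ _ P (Z n) V _ mV (Za n))//.
  congr (P _); apply/seteqP; split=> w; rewrite /= /V big_ord_recr/=.
    by move=> <-; rewrite addrAC subrr add0r.
  by move=> <-; rewrite addrC subrK.
move=> A B mA mB; apply: indep_past => //.
rewrite (_ : _ @^-1` A = (fun w => \sum_(k < n) Z k w) @^-1`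
  ((fun y => a - y) @^-1` A))//.
apply: partial_sum_generated => //.
by rewrite -[X in measurable X]setTI; apply: measurable_funB.
Qed.

Lemma risk_processE (x0 c : R) (N : R -> Omega -> nat)
    (Z : nat -> Omega -> R) w :
  (fun s => risk_process x0 c N Z s w) =
  (fun s => (fun m => x0 - \sum_(k < m) Z k w) (N s w) + c * s).
Proof. by apply/funext => s; rewrite /risk_process addrAC. Qed.

(** A visit to x at a time s at which N does not jump is a point of continuity.
If N jumps at s, to the value m + 1 say, then s is determined by N, as a first
passage time, and X_s = x fixes the value of Z 0 + ... + Z m as a function of N;
each m contributes one null event. *)
Lemma ae_no_jump_onto_level (x0 c x : R) (N : R -> {RV P >-> nat})
  (Z : nat -> {RV P >-> R}) :
  c != 0 ->
  {ae P, forall w, N 0 w = 0%N /\ counting_path (fun s => N s w)} ->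
  mutually_independent P (fun k => Z k : Omega -> R) ->
  (forall k, atomless P (Z k)) ->
  independent_systems P
    (generated_sigma_algebra [set s : R | 0 <= s] (fun s => N s : Omega -> nat))
    (generated_sigma_algebra [set: nat] (fun k => Z k : Omega -> R)) ->
  {ae P, forall w s, 0 < s -> risk_process x0 c N Z s w = x ->
    left_limit (fun r => risk_process x0 c N Z r w) s =
    risk_process x0 c N Z s w}.
Proof.
move=> c0 aeN indep Za indNZ.
pose V m w := x0 - x + c * fine (first_passage (fun s => N s w) m.+1).
have Vnull m : {ae P, forall w, \sum_(k < m.+1) Z k w <> V m w}.
  pose U w := \sum_(k < m.+1) Z k w.
  have mU : measurable_fun setT U by exact: measurable_sum.
  have genV B : measurable B -> generated_sigma_algebra [set s : R | 0 <= s]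
      (fun s => N s : Omega -> nat) (V m @^-1` B).
    move=> mB; have -> : V m @^-1` B =
      (fun w => fine (first_passage (fun s => N s w) m.+1)) @^-1`
        ((fun y => x0 - x + c * y) @^-1` B) by [].
    apply: first_passage_generated; rewrite -[X in measurable X]setTI.
    by apply: measurable_funD => //; exact: measurable_funM.
  have mV : measurable_fun setT (V m).
    move=> _ B mB; rewrite setTI.
    exact: (generated_sigma_algebra_measurable (genV _ mB)).
  exists [set w | V m w = U w]; split => //.
  - exact: measurable_eq_set.
  - apply: (atomless_indep_neq mU mV); first exact: partial_sum_atomless.
    move=> A B mA mB; apply: indNZ; first exact: genV.
    exact: partial_sum_generated.
  - by move=> w /= /contrapT UV; rewrite /U UV.
apply: filterS2 aeN (ae_foralln Vnull) => w [N0 cN] nV s s0 Xsx.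
have [[r /andP[r0 rs] Nr]|nconst] :=
  pselect (exists2 r, 0 <= r < s & N r w = N s w).
  have rs0 : 0 <= r < s by rewrite r0.
  rewrite risk_processE.
  by rewrite (counting_path_no_jump (fun m => x0 - \sum_(k < m) Z k w) c
    cN rs0 Nr)
    /risk_process addrAC.
have jump r : 0 <= r < s -> (N r w < N s w)%N.
  move=> /andP[r0 rs]; rewrite ltn_neqAle cN.1 ?andbT//; last exact: ltW.
  by apply/eqP => Nr; apply: nconst; exists r => //; rewrite r0.
exfalso; have := jump 0; rewrite lexx s0 N0 => /(_ isT) Ns.
apply: (nV (N s w).-1); rewrite /V prednK//.
rewrite (first_passage_jump cN (ltW s0) jump)/=.
by rewrite -Xsx /risk_process; move: (\sum_(_ < _) _) => S; ring.
Qed.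

End no_jump.

Theorem theorem1 (d : measure_display) (Omega : measurableType d)
    (R : realType) (P : probability Omega R)
    (x0 c alpha : R) (hx0 : 0 <= x0) (hc : 0 < c) (halpha : 0 < alpha)
    (N : R -> {RV P >-> nat}) (hN : poisson_process alpha N)
    (Z : nat -> {RV P >-> R})
    (hZ_ge0 : forall k w, 0 <= Z k w)
    (hZ_indep : mutually_independent P (fun k => Z k : Omega -> R))
    (hZ_id : identically_distributed Z)
    (hNZ : independent_systems P
       (generated_sigma_algebra [set s : R | 0 <= s] (fun s => N s : Omega -> nat))
       (generated_sigma_algebra [set: nat] (fun k => Z k : Omega -> R)))
    (hZ_mean : ('E_P[Z 0%N] < +oo)%E)
    (hZ_dens : has_density (Z 0%N))
    (t x : R) (ht : 0 < t) :
  let X (w : Omega) (s : R) : R := risk_process x0 c N Z s w in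
  [/\ {ae P, forall w, 0 <= local_time x0 c (X w) t x /\
        (forall s u, 0 <= s -> s <= u ->
           local_time x0 c (X w) s x <= local_time x0 c (X w) u x)},
      {ae P, forall w,
        (local_time x0 c (X w) t x)%:E =
        ((c^-1)%:E * ((2^-1 * \1_[set X w t] x)%:E
                      + (2^-1 * \1_[set X w 0] x)%:E
                      + crossings (X w) t x))%E} &
      forall g : R -> R, measurable_fun setT g ->
        (exists M : R, forall y, `|g y| <= M) ->
        {ae P, forall w,
          (\int[lebesgue_measure]_(s in `[0%R, t]) (g (X w s))%:E)%E =
          (\int[lebesgue_measure]_y
             (g y * local_time x0 c (X w) t y)%:E)%E}].
Proof.
move=> X.
have ae_path : {ae P, forall w, N 0 w = 0%N /\ counting_path (fun s => N s w)}.
  by have [path _ _] := hN; apply: filterS path => w [N0 mono right].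
have path_sawtooth w : N 0 w = 0%N -> counting_path (fun s => N s w) ->
    x0 = X w 0 /\ sawtooth c (X w).
  move=> N0 cN; split; last first.
    rewrite /X risk_processE.
    exact: (sawtooth_counting_path (fun m => x0 - \sum_(k < m) Z k w) c cN).
  by rewrite /X /risk_process N0 big_ord0 mulr0 addr0 subr0.
have Z_atomless k : atomless P (Z k).
  move=> a; rewrite -(has_density_atomless hZ_dens a).
  exact: hZ_id (measurable_set1 a).
split.
- apply: filterS ae_path => w [N0 cN]; have [-> saw] := path_sawtooth w N0 cN.
  have mono := local_time_nondecreasing x hc saw.
  split; last by move=> s u; exact: mono.
  by apply: le_trans (mono 0 t _ (ltW ht)) => //; rewrite local_time0.
- have ae_nojump := ae_no_jump_onto_level x0 x (lt0r_neq0 hc) ae_path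
    hZ_indep Z_atomless hNZ.
  apply: filterS2 ae_path ae_nojump => w [N0 cN] nojump.
  have [x0E saw] := path_sawtooth w N0 cN.
  rewrite {1}x0E; exact: local_time_crossings.
- move=> g mg bg; apply: filterS ae_path => w [N0 cN].
  have [-> saw] := path_sawtooth w N0 cN.
  exact: occupation_formula (ltW ht).
Qed.
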